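(* Let $p$ be a prime, let $G$ be a finite direct indecomposable $p$-group and let $\mathbb{F}_p$ be the field with $p$ elements. Suppose that at least one of the following holds: (1) $G$ can be generated by $3$ elements; (2) the derived subgroup $G'$ is cyclic. Then $\mathbb{F}_p G$ is indecomposable as a tensor product of proper subalgebras, i.e. there do not exist proper subalgebras $B$ and $C$ of $\mathbb{F}_pG$ with $\mathbb{F}_pG=B\otimes_{\mathbb{F}_p}C$.
   Context: A group is direct indecomposable if it is not the internal direct product of two nontrivial subgroups. For subalgebras $B$ and $C$ of a $k$-algebra $A$ (subalgebras are unital, i.e. contain $1_A$), $A=B\otimes_k C$ means that the elements of $B$ commute with the elements of $C$ and the multiplication map $B\otimes_k C\to A$, $b\otimes c\mapsto bc$, is an isomorphism of $k$-algebras. In (1), ''can be generated by $3$ elements'' includes groups generated by fewer than $3$ elements. *)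

(* Defs.v *)
From HB Require Import structures.
From mathcomp Require Import all_boot all_order all_algebra all_fingroup.
From mathcomp Require Import all_solvable all_field.

Set Implicit Arguments.
Unset Strict Implicit.
Unset Printing Implicit Defensive.

Import GRing.Theory.
Local Open Scope ring_scope.

(* The group algebra K[gT]: functions gT -> K under convolution.  The alias
   keeps this product apart from the pointwise one on {ffun gT -> K}. *)
Definition group_algebra (K : fieldType) (gT : finGroupType) : Type :=
  {ffun gT -> K^o}.

Section GroupAlgebra.

Variables (K : fieldType) (gT : finGroupType).
Local Notation KG := (group_algebra K gT).

HB.instance Definition _ := Vector.copy KG {ffun gT -> K^o}.

Implicit Types f g h : KG.

Definition ga_fun f : gT -> K := fun x => (f : {ffun gT -> K^o}) x.

Definition ga_elt (x : gT) : KG := [ffun y : gT => (y == x)%:R : K^o].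

Definition ga_mul f g : KG :=
  [ffun x : gT => \sum_(y : gT) ga_fun f y * ga_fun g (y^-1 * x)%g : K^o].

Lemma ga_ext f g : (forall x, ga_fun f x = ga_fun g x) -> f = g.
Proof. by move=> efg; apply/ffunP. Qed.

Lemma ga_mulE f g x :
  ga_fun (ga_mul f g) x = \sum_(y : gT) ga_fun f y * ga_fun g (y^-1 * x)%g.
Proof. by rewrite /ga_fun ffunE. Qed.

Lemma ga_eltE x y : ga_fun (ga_elt x) y = (y == x)%:R.
Proof. by rewrite /ga_fun ffunE. Qed.

Lemma ga_addE f g x : ga_fun (f + g) x = ga_fun f x + ga_fun g x.
Proof. by rewrite /ga_fun ffunE. Qed.

Lemma ga_scaleE a f x : ga_fun (a *: f) x = a * ga_fun f x.
Proof. by rewrite /ga_fun ffunE. Qed.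

Fact ga_mulA : associative ga_mul.
Proof.
move=> f g h; apply: ga_ext => x; rewrite !ga_mulE.
under eq_bigr do rewrite ga_mulE mulr_sumr.
under [RHS]eq_bigr do rewrite ga_mulE mulr_suml.
rewrite [RHS]exchange_big; apply: eq_bigr => y _ /=.
rewrite [RHS](reindex_inj (mulgI y)); apply: eq_bigr => z _ /=.
by rewrite mulKg invMg -mulgA mulrA.
Qed.

Fact ga_mul1l : left_id (ga_elt 1%g) ga_mul.
Proof.
move=> f; apply: ga_ext => x; rewrite ga_mulE (bigD1 1%g) //= ga_eltE eqxx.
rewrite mul1r invg1 mul1g big1 ?addr0 // => y /negPf y1.
by rewrite ga_eltE y1 mul0r.
Qed.

Fact ga_mul1r : right_id (ga_elt 1%g) ga_mul.
Proof.
move=> f; apply: ga_ext => x; rewrite ga_mulE (bigD1 x) //= ga_eltE mulVg eqxx.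
rewrite mulr1 big1 ?addr0 // => y nyx.
by rewrite ga_eltE -eq_mulVg1 (negPf nyx) mulr0.
Qed.

Fact ga_mulDl : left_distributive ga_mul +%R.
Proof.
move=> f g h; apply: ga_ext => x; rewrite ga_addE !ga_mulE -big_split.
by apply: eq_bigr => y _; rewrite ga_addE mulrDl.
Qed.

Fact ga_mulDr : right_distributive ga_mul +%R.
Proof.
move=> f g h; apply: ga_ext => x; rewrite ga_addE !ga_mulE -big_split.
by apply: eq_bigr => y _; rewrite ga_addE mulrDr.
Qed.

Fact ga_1_neq0 : ga_elt 1%g != 0.
Proof.
apply/eqP => /(congr1 (ga_fun^~ 1%g)); rewrite ga_eltE eqxx /ga_fun ffunE.
by apply/eqP; rewrite oner_eq0.
Qed.

HB.instance Definition _ := GRing.Zmodule_isNzRing.Build KG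
  ga_mulA ga_mul1l ga_mul1r ga_mulDl ga_mulDr ga_1_neq0.

Fact ga_scaleAl a f g : a *: (f * g) = (a *: f) * g.
Proof.
apply: ga_ext => x; rewrite ga_scaleE !ga_mulE mulr_sumr.
by apply: eq_bigr => y _; rewrite ga_scaleE mulrA.
Qed.

HB.instance Definition _ := GRing.Lmodule_isLalgebra.Build K KG ga_scaleAl.

Fact ga_scaleAr a f g : a *: (f * g) = f * (a *: g).
Proof.
apply: ga_ext => x; rewrite ga_scaleE !ga_mulE mulr_sumr.
by apply: eq_bigr => y _; rewrite ga_scaleE mulrCA.
Qed.

HB.instance Definition _ := GRing.Lalgebra_isAlgebra.Build K KG ga_scaleAr.
HB.instance Definition _ := Algebra_isFalgebra.Build K KG.

Lemma ga_eltM x y : ga_elt (x * y)%g = ga_elt x * ga_elt y.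
Proof.
apply: ga_ext => z; rewrite ga_mulE (bigD1 x) //= !ga_eltE eqxx mul1r.
rewrite big1 ?addr0 => [|t /negPf ntx]; last by rewrite ga_eltE ntx mul0r.
by rewrite (canF_eq (mulKVg x)).
Qed.

Lemma ga_sum f : f = \sum_(x : gT) ga_fun f x *: ga_elt x.
Proof.
apply: ga_ext => z; rewrite {2}/ga_fun sum_ffunE (bigD1 z) //= !ffunE eqxx.
rewrite [_ *: _]mulr1 big1 ?addr0 // => x /negPf nxz.
by rewrite !ffunE eq_sym nxz scaler0.
Qed.

End GroupAlgebra.

(* Coordinates in the bases fixed by v2r identify U (x) V with matrices, a pure
   tensor u (x) v being a matrix of rank at most 1; tens_liftE and tens_ext
   below give the universal property. *)
Definition tensor (K : fieldType) (U V : vectType K) : Type :=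
  'M[K]_(dim U, dim V).

Import VectorInternalTheory.

Lemma linear_sumZ (K : fieldType) (U W : lmodType K) (f : U -> W) :
  linear f -> forall (I : finType) (a : I -> K) (x : I -> U),
  f (\sum_i a i *: x i) = \sum_i a i *: f (x i).
Proof.
move=> fl I a x; pose F : {linear U -> W} := HB.pack f
  (GRing.isSemilinear.Build K U W _ f (GRing.semilinear_linear fl)).
rewrite -[f _]/(F _) linear_sum; apply: eq_bigr => i _; exact: linearZ.
Qed.

Section TensorSpace.

Variables (K : fieldType) (U V : vectType K).
Local Notation T := (tensor U V).

HB.instance Definition _ := Vector.copy T 'M[K]_(dim U, dim V).

Definition tens (u : U) (v : V) : T := (v2r u)^T *m v2r v.

Definition tens_lift (W : lmodType K) (f : U -> V -> W) (t : T) : W :=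
  \sum_i \sum_j (t : 'M_(dim U, dim V)) i j *:
    f (r2v (delta_mx 0 i)) (r2v (delta_mx 0 j)).

Lemma tensPl a u u' v : tens (a *: u + u') v = a *: tens u v + tens u' v.
Proof. by rewrite /tens linearP linearP mulmxDl -scalemxAl. Qed.

Lemma tensPr a u v v' : tens u (a *: v + v') = a *: tens u v + tens u v'.
Proof. by rewrite /tens linearP mulmxDr -scalemxAr. Qed.

Lemma tens_lift_linear (W : lmodType K) (f : U -> V -> W) : linear (tens_lift f).
Proof.
move=> a s t; rewrite /tens_lift scaler_sumr -big_split; apply: eq_bigr => i _.
rewrite scaler_sumr -big_split; apply: eq_bigr => j _ /=.
by rewrite !mxE scalerDl scalerA.
Qed.

Lemma tens_liftE (W : lmodType K) (f : U -> V -> W) :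
    (forall v, linear (f^~ v)) -> (forall u, linear (f u)) ->
  forall u v, tens_lift f (tens u v) = f u v.
Proof.
move=> fl fr u v.
have uE: u = \sum_i v2r u 0 i *: r2v (delta_mx 0 i).
  rewrite -[LHS]v2rK [v2r u in LHS]row_sum_delta linear_sum.
  by apply: eq_bigr => i _; rewrite linearZ.
have vE: v = \sum_j v2r v 0 j *: r2v (delta_mx 0 j).
  rewrite -[LHS]v2rK [v2r v in LHS]row_sum_delta linear_sum.
  by apply: eq_bigr => j _; rewrite linearZ.
rewrite [in RHS]uE (linear_sumZ (fl v)); apply: eq_bigr => i _.
rewrite [in RHS]vE (linear_sumZ (fr _)) scaler_sumr; apply: eq_bigr => j _.
by rewrite scalerA !mxE big_ord1 !mxE.
Qed.

Lemma tens_ext (W : lmodType K) (f g : T -> W) :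
    linear f -> linear g -> (forall u v, f (tens u v) = g (tens u v)) ->
  f =1 g.
Proof.
move=> fl gl efg t.
have tE: t = \sum_(p : 'I_(dim U) * 'I_(dim V))
    (t : 'M_(_, _)) p.1 p.2 *: (delta_mx p.1 p.2 : T).
  rewrite [LHS]matrix_sum_delta.
  by rewrite (pair_big xpredT xpredT
    (fun i j => (t : 'M_(_, _)) i j *: (delta_mx i j : T))).
rewrite tE (linear_sumZ fl) (linear_sumZ gl); apply: eq_bigr => -[i j] _ /=.
have -> : delta_mx i j = tens (r2v (delta_mx 0 i)) (r2v (delta_mx 0 j)).
  by rewrite /tens !r2vK trmx_delta mul_delta_mx.
by rewrite efg.
Qed.

Lemma eq_tens_lift (W : lmodType K) (f g : U -> V -> W) :
  (forall u v, f u v = g u v) -> tens_lift f =1 tens_lift g.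
Proof.
by move=> efg t; apply: eq_bigr => i _; apply: eq_bigr => j _; rewrite efg.
Qed.

Lemma tens_liftP (W : lmodType K) a (f g : U -> V -> W) t :
  tens_lift (fun u v => a *: f u v + g u v) t
    = a *: tens_lift f t + tens_lift g t.
Proof.
rewrite /tens_lift scaler_sumr -big_split; apply: eq_bigr => i _.
rewrite scaler_sumr -big_split; apply: eq_bigr => j _ /=.
by rewrite scalerDr !scalerA mulrC.
Qed.

End TensorSpace.

Section TensorAlgebra.

Variables (K : fieldType) (A B : falgType K).
Local Notation T := (tensor A B).

(* The bilinear product with (a (x) b)(a' (x) b') = aa' (x) bb'. *)
Definition tens_mul (s t : T) : T :=
  tens_lift (fun a b => tens_lift (fun a' b' => tens (a * a') (b * b')) t) s.

Fact tens_mulPl t : linear (tens_mul^~ t).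
Proof. exact: tens_lift_linear. Qed.

Fact tens_mulPr s : linear (tens_mul s).
Proof.
move=> c t t'; rewrite -tens_liftP; apply: eq_tens_lift => a b.
exact: tens_lift_linear.
Qed.

Lemma tens_mulE a b a' b' :
  tens_mul (tens a b) (tens a' b') = tens (a * a') (b * b').
Proof.
rewrite /tens_mul (tens_liftE (f := fun a b => tens_lift
  (fun a' b' => tens (a * a') (b * b')) (tens a' b'))); first last.
- move=> x c y y'; rewrite -tens_liftP; apply: eq_tens_lift => z z'.
  by rewrite mulrDl -scalerAl tensPr.
- move=> y c x x'; rewrite -tens_liftP; apply: eq_tens_lift => z z'.
  by rewrite mulrDl -scalerAl tensPl.
rewrite (tens_liftE (f := fun x y => tens (a * x) (b * y))) // => z c x y.
  by rewrite mulrDr -scalerAr tensPl.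
by rewrite mulrDr -scalerAr tensPr.
Qed.

Fact tens_mulA : associative tens_mul.
Proof.
move=> x y z; move: x; apply: tens_ext => [c s t|c s t|a b].
- exact: tens_mulPl.
- by rewrite !tens_mulPl.
move: y; apply: tens_ext => [c s t|c s t|a' b'].
- by rewrite tens_mulPl tens_mulPr.
- by rewrite tens_mulPr tens_mulPl.
move: z; apply: tens_ext => [c s t|c s t|a'' b''].
- by rewrite !tens_mulPr.
- exact: tens_mulPr.
by rewrite !tens_mulE !mulrA.
Qed.

Fact tens_mul1l : left_id (tens 1 1) tens_mul.
Proof.
apply: tens_ext => [||a b]; [exact: tens_mulPr | by [] |].
by rewrite tens_mulE !mul1r.
Qed.

Fact tens_mul1r : right_id (tens 1 1) tens_mul.
Proof.
apply: tens_ext => [||a b]; [exact: tens_mulPl | by [] |].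
by rewrite tens_mulE !mulr1.
Qed.

Fact tens_mulDl : left_distributive tens_mul +%R.
Proof. by move=> s t u; have:= tens_mulPl u 1 s t; rewrite !scale1r. Qed.

Fact tens_mulDr : right_distributive tens_mul +%R.
Proof. by move=> s t u; have:= tens_mulPr s 1 t u; rewrite !scale1r. Qed.

Fact tens_1_neq0 : tens 1 1 != 0 :> T.
Proof.
have nz (C : falgType K) : {i | v2r (1 : C) 0 i != 0}.
  apply: sigW; apply/rV0Pn/eqP => v0; have /eqP[] := oner_neq0 C.
  by apply: v2r_inj; rewrite v0 linear0.
have [[i nzi] [j nzj]] := (nz A, nz B); apply/eqP => /matrixP/(_ i j)/eqP.
by rewrite /tens !mxE big_ord1 !mxE mulf_eq0 (negPf nzi) (negPf nzj).
Qed.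

HB.instance Definition _ := GRing.Zmodule_isNzRing.Build T
  tens_mulA tens_mul1l tens_mul1r tens_mulDl tens_mulDr tens_1_neq0.

Fact tens_scaleAl c (s t : T) : c *: (s * t) = (c *: s) * t.
Proof.
have := tens_mulPl t c s 0; rewrite -[tens_mul 0 t]/(0 * t) mul0r !addr0.
by move/esym.
Qed.

HB.instance Definition _ := GRing.Lmodule_isLalgebra.Build K T tens_scaleAl.

Fact tens_scaleAr c (s t : T) : c *: (s * t) = s * (c *: t).
Proof.
have := tens_mulPr s c t 0; rewrite -[tens_mul s 0]/(s * 0) mulr0 !addr0.
by move/esym.
Qed.

HB.instance Definition _ := GRing.Lalgebra_isAlgebra.Build K T tens_scaleAr.
HB.instance Definition _ := Algebra_isFalgebra.Build K T.

Lemma tensM a b a' b' : tens a b * tens a' b' = tens (a * a') (b * b') :> T.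
Proof. exact: tens_mulE. Qed.

End TensorAlgebra.

(* {aspace A} only asks for a relative identity, hence the conditions 1 \in _;
   under them, 1 in subvs_of B and subvs_of C is 1 in A. *)
Definition internal_tensor (K : fieldType) (A : falgType K)
    (B C : {aspace A}) : Prop :=
  [/\ 1 \in B, 1 \in C,
      forall b c, b \in B -> c \in C -> b * c = c * b &
      exists f : {lrmorphism tensor (subvs_of B) (subvs_of C) -> A},
        (forall b c, f (tens b c) = vsval b * vsval c) /\ bijective f].

Definition direct_indecomposable (gT : finGroupType) (G : {group gT}) : Prop :=
  forall H K : {group gT}, (H \x K = G)%g -> H :=: 1%g \/ K :=: 1%g.

(* Main.v *)
From HB Require Import structures.
Require Import Defs.
From mathcomp Require Import all_boot all_order all_algebra all_fingroup.
From mathcomp Require Import all_solvable all_field.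
From mathcomp Require Import mxrepresentation mxabelem.

(* Let A = K[G] = B (x) C, let I be the augmentation ideal, nilpotent
   because G is a p-group, and let piB, piC : A -> A be the retractions onto
   B and C that apply the augmentation to the other factor.
   (a) If C is commutative and nontrivial, G has a nontrivial central cyclic
   direct factor.  Let phi be the restriction of piC to G and k be minimal
   such that phi(g)^(p^(k+1)) = 1 for all g; then f = phi(g) - 1, for a g
   with phi(g)^(p^k) != 1, is central.  Write f = u + w with u supported on
   Z(G) and w on its complement.  Sums of class functions over noncentral
   classes vanish in characteristic p, so piC(w) = 0, and f^(p^(k+1)) = 0
   gives u^(p^(k+1)) = 0.  As piC(u^(p^k)) = f^(p^k) is nonzero, some z in
   Z(G) has z^(p^(k+1)) = 1 and phi(z^(p^k)) != 1.  Its image has maximal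
   order in the abelian group G / ker phi, so <z> splits off there, hence
   also in G.
   (b) I/I^2 is the direct sum of the corresponding quotients for B and C.
   If G has 3 generators, one of these has dimension at most 1, and then
   that factor is generated by one element, hence commutative.
   (c) If G' = <c>, the ideal generated by commutators is A y with
   y = c - 1.  If neither B nor C were commutative, the commutators of B and those
   of C would lie in the ideal I y, forcing y in I y and y = 0.
   So if G is indecomposable, (b) or (c) and then (a) make G cyclic; by (b)
   with one generator, B or C is then trivial. *)

Set Implicit Arguments.
Unset Strict Implicit.
Unset Printing Implicit Defensive.

Import GRing.Theory.
Local Open Scope ring_scope.

(** * Sums of class functions, unipotence of p-groups, central splitting *)

(** A noncentral class has size a positive power of [p], so its equal terms add up to 0. *)
Lemma sum_class_fun_eq0 (p : nat) (gT : finGroupType) (V : zmodType)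
    (f : gT -> V) :
  (p.-group [set: gT])%g -> (forall v : V, v *+ p = 0) ->
  (forall x y, f (x ^ y)%g = f x) -> {in 'Z([set: gT])%g, forall z, f z = 0} ->
  \sum_x f x = 0.
Proof.
move=> pG pV fJ fZ.
rewrite (eq_bigl [in [set: gT]%g]) => [|x]; last by rewrite inE.
rewrite (set_partition_big _ (classes_partition [set: gT])) /=.
rewrite big1 // => _ /imsetP[x _ ->].
rewrite (eq_bigr (fun=> f x)) => [|_ /imsetP[y _ ->]]; last exact: fJ.
rewrite sumr_const -index_cent1.
have [Zx | nZx] := boolP (x \in 'Z([set: gT])%g); first by rewrite fZ ?mul0rn.
have /p_natP[[|n] i_x] : p.-nat #|[set: gT] : 'C_[set: gT][x]|%g.
- exact: pnat_dvd (dvdn_indexg _ _) pG.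
- case/centerP: nZx; split=> [|y _]; first by rewrite inE.
  have := in_setT y; rewrite -[[set: gT]%g](index1g (subsetIl _ 'C[x]%g) i_x).
  by case/setIP=> _ /cent1P/commute_sym.
by rewrite i_x expnS mulrnA pV mul0rn.
Qed.

(* The fixed vectors form a nonzero submodule, so the degree drops in the
   quotient by it. *)
Lemma foldl_mulmx_sub1_eq0 (p : nat) (F : fieldType) (gT : finGroupType)
    (G : {group gT}) (n : nat) (rG : mx_representation F G n) (s : seq gT) :
  p \in [pchar F] -> (p.-group G)%g -> {subset s <= G} -> (n <= size s)%N ->
  forall v : 'rV_n, foldl (fun v g => v *m rG g - v) v s = 0.
Proof.
move=> pF pG; have [m] := ubnP n; elim: m => // m IHm in n rG s *.
rewrite ltnS => le_n_m sG sz v.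
have [n0 | n_gt0] := posnP n; first by apply/matrixP=> i [j ltjn]; exfalso;
  move: ltjn; rewrite n0.
have Umod := rfix_mx_module rG.
set U := rfix_mx rG G in Umod.
have nzU : U != 0 by apply: (rfix_pgroup_pchar pF) => //.
have rk : (\rank (cokermx U) < n)%N.
  by rewrite mxrank_coker ltn_subrL n_gt0 lt0n mxrank_eq0 nzU.
(* By induction the factors before the last send [v] to 0 in the quotient, hence into the fixed
   vectors, on which the last [g] acts trivially. *)
elim/last_ind: s => [|s g _] in sG sz *; first by move: sz;
  rewrite leqNgt n_gt0.
have Gg : g \in G by apply: sG; rewrite mem_rcons inE eqxx.
have {}sG : {subset s <= G} by move=> x sx; apply: sG;
  rewrite mem_rcons inE sx orbT.
rewrite -cats1 foldl_cat /=; set w := foldl _ _ _.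
suffices /rfix_mxP/(_ g Gg)-> : (w <= U)%MS by rewrite subrr.
rewrite -in_factmod_eq0.
suff -> : in_factmod U w = foldl (fun v g => v *m factmod_repr Umod g - v)
  (in_factmod U v) s.
  apply/eqP/IHm => //; first exact: leq_trans rk le_n_m.
  by move: sz; rewrite size_rcons -ltnS; apply: leq_trans rk.
rewrite /w; elim: s sG v {sz w} => //= h s IHs sG v.
rewrite IHs => [|x sx]; last by apply: sG; rewrite inE sx orbT.
by rewrite linearB /= in_factmodJ // sG // inE eqxx.
Qed.

(** Modulo [N] the element [z] keeps its order, which is then the exponent of the abelian group
    [G / N]. So its image generates a direct factor there, and [H] is the preimage of a
    complement. *)
Lemma central_cycle_dprod (gT : finGroupType) (G N : {group gT}) (z : gT) :
  z \in 'Z(G)%g -> (N <| G)%g -> abelian (G / N)%g ->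
  {in G, forall g, (g ^+ #[z])%g \in N} -> (<[z]> :&: N = 1)%g ->
  exists H : {group gT}, (<[z]> \x H)%g = G.
Proof.
move=> /centerP[Gz cGz] nsNG abGN expN tiN.
have [sNG nNG] := andP nsNG; have Nz := subsetP nNG z Gz.
have cN i : (coset N z ^+ i = 1 -> z ^+ i = 1)%g.
  rewrite -morphX // => /(coset_idr (groupX _ Nz)) Nzi.
  by apply/set1gP; rewrite -tiN inE Nzi mem_cycle.
have oz : #[coset N z]%g = #[z]%g.
  apply/eqP; rewrite eqn_dvd !order_dvdn cN ?expg_order // -morphX //.
  by rewrite expg_order (morph1 (coset N)) !eqxx.
have /splitsP[K /complP[tiK defQ]] : ([splits G / N, over <[coset N z]>])%g.
  apply: abelian_splits => //; first by rewrite mem_quotient.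
  apply/eqP; rewrite eqn_dvd dvdn_exponent ?mem_quotient //=.
  apply/exponentP=> _ /morphimP[g Ng Gg ->]; rewrite -morphX // oz.
  by apply: coset_id; apply: expN.
have sKQ : (K \subset G / N)%g by rewrite -defQ mulG_subr.
pose H := (G :&: coset N @*^-1 K)%G; exists H.
rewrite dprodE.
- apply/eqP; rewrite eqEsubset mulG_subG cycle_subG Gz subsetIl /=.
  apply/subsetP => g Gg; have Ng := subsetP nNG g Gg.
  have : coset N g \in (G / N)%g by apply: mem_quotient.
  rewrite -defQ => /mulsgP[_ k /cycleP[i ->] Kk def_g].
  rewrite -(mulKVg (z ^+ i)%g g) mem_mulg ?mem_cycle //.
  apply/setIP; split; first by rewrite groupM ?groupV ?groupX.
  apply/morphpreP; split; first by rewrite groupM ?groupV ?groupX.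
  rewrite morphM ?groupV ?groupX // morphV ?groupX // morphX //=.
  by rewrite def_g mulKg.
- apply/centsP => h /setIP[Gh _] _ /cycleP[i ->].
  exact/commuteX/commute_sym/cGz.
- apply/trivgP/subsetP=> _ /setIP[/cycleP[i ->] /setIP[_ /morphpreP[_ Kzi]]].
  apply/set1gP/cN/set1gP; rewrite -tiK inE -morphX // Kzi andbT.
  by rewrite morphX // mem_cycle.
Qed.

(** * The augmentation ideal and its nilpotency *)

Section Augmentation.

Variables (K : fieldType) (gT : finGroupType).
Local Notation KG := (group_algebra K gT).
Implicit Types (f g : KG) (x y : gT).

Lemma ga_fun_sum (I : Type) (r : seq I) (P : pred I) (F : I -> KG) x :
  ga_fun (\sum_(i <- r | P i) F i) x = \sum_(i <- r | P i) ga_fun (F i) x.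
Proof.
elim/big_rec2: _ => [|i f g _ <-]; last by rewrite ga_addE.
by rewrite /ga_fun ffunE.
Qed.

Definition aug f : K^o := \sum_x ga_fun f x.

Lemma augP : linear aug.
Proof.
move=> a f g; rewrite /aug scaler_sumr -big_split.
by apply: eq_bigr => x _; rewrite ga_addE ga_scaleE.
Qed.

Lemma aug_elt x : aug (ga_elt K x) = 1.
Proof.
rewrite /aug (bigD1 x) //= ga_eltE eqxx big1 ?addr0 // => y /negPf nyx.
by rewrite ga_eltE nyx.
Qed.

Lemma augM : GRing.monoid_morphism aug.
Proof.
split=> [|f g]; first exact: aug_elt.
rewrite /aug [LHS](eq_bigr _ (fun x _ => ga_mulE f g x)) exchange_big mulr_suml.
apply: eq_bigr => y _ /=; rewrite -mulr_sumr; congr (_ * _).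
rewrite (reindex_inj (mulgI y)); apply: eq_bigr => x _.
by rewrite mulKg.
Qed.

HB.instance Definition _ := GRing.isLinear.Build K KG K^o *:%R aug augP.
HB.instance Definition _ := GRing.isMonoidMorphism.Build KG K^o aug augM.

Definition aug_ideal : {vspace KG} := lker (linfun aug).

Lemma mem_aug f : (f \in aug_ideal) = (aug f == 0).
Proof. by rewrite memv_ker lfunE. Qed.

Lemma aug_sub1 x : ga_elt K x - 1 \in aug_ideal.
Proof. by rewrite mem_aug rmorphB rmorph1 /= aug_elt subrr. Qed.

Lemma aug_sum f : f \in aug_ideal ->
  f = \sum_x ga_fun f x *: (ga_elt K x - 1).
Proof.
rewrite mem_aug => /eqP f0; under eq_bigr do rewrite scalerBr.
by rewrite sumrB -ga_sum -scaler_suml [X in X *: _]f0 scale0r subr0.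
Qed.

Lemma aug_ideal_min (V : {vspace KG}) :
  (forall x, ga_elt K x - 1 \in V) -> (aug_ideal <= V)%VS.
Proof.
move=> sV; apply/subvP=> f /aug_sum->; apply: memv_suml => x _.
exact: memvZ.
Qed.

Lemma aug_idealMl f g : g \in aug_ideal -> f * g \in aug_ideal.
Proof. by rewrite !mem_aug rmorphM /= => /eqP->; rewrite mulr0. Qed.

Lemma aug_idealMr f g : f \in aug_ideal -> f * g \in aug_ideal.
Proof. by rewrite !mem_aug rmorphM /= => /eqP->; rewrite mul0r. Qed.

Section RegularRepresentation.
Import VectorInternalTheory.

Definition ga_reg_mx x := lin1_mx (v2r \o amulr (ga_elt K x) \o r2v).

Lemma ga_reg_mxE f x : v2r f *m ga_reg_mx x = v2r (f * ga_elt K x).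
Proof. by rewrite mul_rV_lin1 /= v2rK lfunE. Qed.

Lemma ga_reg_mxP : mx_repr [set: gT] ga_reg_mx.
Proof.
split=> [|x y _ _]; apply/row_matrixP=> i; rewrite !rowE -[delta_mx 0 i]r2vK.
  by rewrite ga_reg_mxE mulmx1 [X in v2r X](_ :
    _ = r2v (delta_mx 0 i)) ?[LHS]mulr1.
by rewrite mulmxA !ga_reg_mxE ga_eltM mulrA.
Qed.

Lemma aug_ideal_nilp (p : nat) : p \in [pchar K] -> (p.-group [set: gT])%g ->
  (exists n, aug_ideal ^+ n = 0)%VS.
Proof.
move=> pK pG; pose n := dim KG; exists n.
have prod0 (s : seq gT) : size s = n -> \prod_(x <- s) (ga_elt K x - 1) = 0.
  move=> sz; apply: v2r_inj; rewrite linear0.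
  rewrite -(foldl_mulmx_sub1_eq0 (MxRepresentation ga_reg_mxP) pK pG (s := s)
    (fun x _ => in_setT x) _ (v2r 1)) ?sz //=.
  suff E f : v2r (f * \prod_(x <- s) (ga_elt K x - 1)) =
    foldl (fun v x => v *m ga_reg_mx x - v) (v2r f) s by rewrite -E mul1r.
  elim: s {sz} f => [|x s IHs] f; first by rewrite big_nil mulr1.
  by rewrite big_cons mulrA IHs /= ga_reg_mxE mulrBr mulr1 linearB.
(* The left factor [W] lets the induction absorb one copy of the ideal at a time; in each copy only
   the spanning elements x - 1 need checking. *)
suff I0 m (W : {vspace KG}) : (forall s w, size s = m -> w \in W ->
    w * \prod_(x <- s) (ga_elt K x - 1) = 0) -> (W * aug_ideal ^+ m = 0)%VS.
  by rewrite -[LHS]prod1v; apply: I0 => s w sz _; rewrite prod0 ?mulr0.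
elim: m W => [|m IHm] W W0.
  rewrite expv0 prodv1; apply/eqP; rewrite -subv0; apply/subvP=> w Ww.
  by rewrite memv0 -(mulr1 w) -(W0 [::] w) // big_nil.
rewrite expvSl prodvA; apply: IHm => s f sz /(subvP _) sWI.
suff /sWI : (W * aug_ideal <= lker (amulr (\prod_(x <- s) (ga_elt K x -
  1))))%VS.
  by rewrite memv_ker lfunE => /eqP.
apply/prodvP=> w g Ww Ig; rewrite memv_ker lfunE /=.
set P := \prod_(x <- s) _.
suff /subvP sI : (aug_ideal <= lker (amulr P \o amull w))%VS.
  by have:= sI g Ig; rewrite memv_ker comp_lfunE !lfunE.
apply: aug_ideal_min => x; rewrite memv_ker comp_lfunE !lfunE /=.
by rewrite -mulrA; have := W0 (x :: s) w; rewrite big_cons /= sz => ->.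
Qed.
End RegularRepresentation.

End Augmentation.

(** * Commutative retracts and central cyclic direct factors *)

Lemma exprD_pchar_comm (R : nzRingType) (p k : nat) (x y : R) :
  p \in [pchar R] -> GRing.comm x y ->
  (x + y) ^+ (p ^ k) = x ^+ (p ^ k) + y ^+ (p ^ k).
Proof.
move=> pR cxy; elim: k => [|k IHk]; first by rewrite !expn0 !expr1.
rewrite expnSr !exprM IHk -!(pFrobenius_autE pR) pFrobenius_autD_comm //.
exact/commrX/commr_sym/commrX/commr_sym.
Qed.

Lemma expr_sum_pchar_comm (R : nzRingType) (p k : nat) (I : finType)
    (P : pred I) (F : I -> R) :
  p \in [pchar R] -> (forall i j, GRing.comm (F i) (F j)) ->
  (\sum_(i | P i) F i) ^+ (p ^ k) = \sum_(i | P i) F i ^+ (p ^ k).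
Proof.
move=> pR cF.
suff [] : (\sum_(i | P i) F i) ^+ (p ^ k) = \sum_(i | P i) F i ^+ (p ^ k) /\
  forall j, GRing.comm (F j) (\sum_(i | P i) F i) by [].
elim/big_rec2: _ => [|i y x _ [<- cx]].
  split=> [|j]; last exact: commr0.
  by rewrite expr0n expn_eq0 (gtn_eqF (prime_gt0 (pcharf_prime pR))).
split=> [|j]; first exact: exprD_pchar_comm.
exact: commrD.
Qed.

Lemma sub1_pchar_comm (R : nzRingType) (p k : nat) (x : R) :
  p \in [pchar R] -> (x - 1) ^+ (p ^ k) = x ^+ (p ^ k) - 1.
Proof.
move=> pR; have := exprD_pchar_comm k pR (commr1 (x - 1)).
by rewrite subrK expr1n => ->; rewrite addrK.
Qed.

Section CentralFactor.

Variables (K : fieldType) (gT : finGroupType) (p : nat).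
Hypotheses (pK : p \in [pchar K]) (pG : (p.-group [set: gT])%g).
Local Notation KG := (group_algebra K gT).
Implicit Types (f g : KG) (x y z : gT).

Lemma pchar_ga : p \in [pchar KG].
Proof. by rewrite pchar_lalg. Qed.

Lemma mulrn_pchar_ga f : f *+ p = 0.
Proof. exact: (mulrn_pchar pchar_ga). Qed.

Lemma ga_eltX x n : ga_elt K (x ^+ n)%g = ga_elt K x ^+ n.
Proof. by elim: n => // n IHn; rewrite expgS exprS ga_eltM IHn. Qed.

Lemma ga_fun_eltMl x f y : ga_fun (ga_elt K x * f) y = ga_fun f (x^-1 * y)%g.
Proof.
rewrite ga_mulE (bigD1 x) //= ga_eltE eqxx mul1r big1 ?addr0 // => t /negPf ntx.
by rewrite ga_eltE ntx mul0r.
Qed.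

Lemma ga_fun_eltMr x f y : ga_fun (f * ga_elt K x) y = ga_fun f (y * x^-1)%g.
Proof.
rewrite ga_mulE (bigD1 (y * x^-1)%g) //= ga_eltE invMg invgK mulgKV eqxx mulr1.
rewrite big1 ?addr0 // => t /negPf nt; rewrite ga_eltE.
by rewrite (canF_eq (mulKVg t)) eq_sym (canF_eq (mulgK x)) nt mulr0.
Qed.

Lemma central_ga_funJ f :
  (forall g, f * g = g * f) -> forall x y, ga_fun f (x ^ y)%g = ga_fun f x.
Proof.
move=> cf x y; have := congr1 (fun h => ga_fun h (x * y)%g) (cf (ga_elt K y)).
by rewrite ga_fun_eltMr ga_fun_eltMl mulgK conjgE mulgA.
Qed.

Lemma ga_elt_central z f :
  z \in 'Z([set: gT])%g -> ga_elt K z * f = f * ga_elt K z.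
Proof.
case/centerP=> _ cz; apply: ga_ext => y; rewrite ga_fun_eltMr ga_fun_eltMl.
by congr ga_fun; apply/commute_sym/commuteV/commute_sym/cz; rewrite inE.
Qed.

Definition central_part f : KG :=
  \sum_(z in 'Z([set: gT])%g) ga_fun f z *: ga_elt K z.

Lemma central_partP f g : central_part f * g = g * central_part f.
Proof.
rewrite /central_part mulr_suml mulr_sumr; apply: eq_bigr => z Zz.
by rewrite -scalerAl -scalerAr ga_elt_central.
Qed.

Lemma central_partE f z :
  z \in 'Z([set: gT])%g -> ga_fun (central_part f) z = ga_fun f z.
Proof.
move=> Zz; rewrite ga_fun_sum (bigD1 z) //= ga_scaleE ga_eltE eqxx mulr1.
rewrite big1 ?addr0 // => y /andP[_ /negPf nyz].
by rewrite ga_scaleE ga_eltE eq_sym nyz mulr0.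
Qed.

(** As [z] is central, the terms f(y) g(y^-1 z) of the convolution form a class function of y, which
    vanishes on the centre because [f] does. *)
Lemma ga_funM_central_eq0 f g z :
  (forall h, f * h = h * f) -> (forall h, g * h = h * g) ->
  {in 'Z([set: gT])%g, forall x, ga_fun f x = 0} ->
  z \in 'Z([set: gT])%g -> ga_fun (f * g) z = 0.
Proof.
move=> cf cg f0 /centerP[_ cz]; rewrite ga_mulE.
apply: (sum_class_fun_eq0 pG) => [a|x y|x Zx].
- exact: (mulrn_pchar pK).
- rewrite (central_ga_funJ cf); congr (_ * _).
  rewrite -[in RHS](central_ga_funJ cg _ y) conjMg -conjVg.
  by congr (ga_fun g (_ * _)%g); rewrite conjgE (cz y) ?mulKg // inE.
- by rewrite f0 ?mul0r.
Qed.

Lemma central_partX f k :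
  central_part f ^+ (p ^ k) = \sum_(z in 'Z([set: gT])%g)
    ga_fun f z ^+ (p ^ k) *: ga_elt K (z ^+ (p ^ k))%g.
Proof.
rewrite /central_part big_mkcond expr_sum_pchar_comm; last 2 first.
- exact: pchar_ga.
- move=> y z; case: ifP => [Zy|_]; last exact/commr_sym/commr0.
  case: ifP => [_|_]; last exact: commr0.
  by rewrite /GRing.comm -!scalerAl -!scalerAr ga_elt_central // !scalerA mulrC.
rewrite [RHS]big_mkcond; apply: eq_bigr => z _; case: ifP => _.
  by rewrite exprZn ga_eltX.
by rewrite expr0n expn_eq0 (gtn_eqF (prime_gt0 (pcharf_prime pK))).
Qed.

(** For q = p^k, f^q = u^q + w^q, where u^q is supported on the centre and w^q vanishes there; so
    f^q = 0 forces u^q = 0. *)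
Lemma central_part_nilp f k :
  (forall g, f * g = g * f) -> f ^+ (p ^ k) = 0 ->
  central_part f ^+ (p ^ k) = 0.
Proof.
move=> cf fq0; set u := central_part f; pose w := f - u.
have cw g : w * g = g * w by rewrite mulrBl mulrBr cf central_partP.
have w0 : {in 'Z([set: gT])%g, forall x, ga_fun w x = 0}.
  move=> x Zx; rewrite ga_addE -scaleN1r ga_scaleE central_partE //.
  by rewrite mulN1r subrr.
have q_gt0 : (0 < p ^ k)%N by rewrite expn_gt0 (prime_gt0 (pcharf_prime pK)).
have fq : u ^+ (p ^ k) + w ^+ (p ^ k) = 0.
  rewrite -exprD_pchar_comm; [by rewrite addrC subrK | exact: pchar_ga |].
  exact: central_partP.
apply: ga_ext => z; rewrite [RHS]ffunE.
have [Zz | nZz] := boolP (z \in 'Z([set: gT])%g).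
  have := congr1 (fun h => ga_fun h z) fq; rewrite ga_addE /= [RHS]ffunE.
  rewrite -(prednK q_gt0) [w ^+ _]exprS ga_funM_central_eq0 ?addr0 // => h.
  exact/commr_sym/commrX/commr_sym/cw.
rewrite central_partX ga_fun_sum big1 // => y Zy; rewrite ga_scaleE ga_eltE.
by case: eqP nZz => [->|_ _]; [rewrite groupX | rewrite mulr0].
Qed.

(** Step (a), where [pi] is the retraction onto a commutative tensor factor, whose image is
    central. *)
Lemma central_retract_dprod (pi : {lrmorphism KG -> KG}) :
  (forall f, pi (pi f) = pi f) -> (forall f g, pi f * g = g * pi f) ->
  (exists x, pi (ga_elt K x) != 1) ->
  exists (z : gT) (H : {group gT}), z != 1%g /\ (<[z]> \x H)%g = [set: gT].
Proof.
move=> piK pi_central [x0 pi_x0].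
pose phi x := pi (ga_elt K x).
have phiM x y : phi (x * y)%g = phi x * phi y by rewrite /phi ga_eltM rmorphM.
have phi1 : phi 1%g = 1 by rewrite /phi -[ga_elt K 1%g]/(1 : KG) rmorph1.
have phiX x n : phi (x ^+ n)%g = phi x ^+ n by rewrite /phi ga_eltX rmorphXn.
have phiJ x y : phi (x ^ y)%g = phi x.
  by rewrite conjgE !phiM pi_central -mulrA -phiM mulgV phi1 mulr1.
have exk : exists k, [forall x, phi x ^+ (p ^ k) == 1].
  case: (p_natP pG) => k def_k; exists k; apply/forallP=> x.
  by rewrite -phiX -def_k expg_cardG ?inE // phi1.
(* The least exponent is not 0 because [phi x0] is not 1, so it has the form k + 1. *)
have := ex_minnP exk; case=> -[|k] /forallP phi_q min_k.
  by move: (phi_q x0); rewrite expn0 expr1 (negPf pi_x0).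
have /forallPn[x1 phi_x1] : ~~ [forall x, phi x ^+ (p ^ k) == 1].
  by apply: contraL (leqnn k) => /min_k; rewrite -ltnNge.
pose f := phi x1 - 1.
have cf g : f * g = g * f by rewrite mulrBl mulrBr mul1r mulr1 pi_central.
have pi_f : pi f = f by rewrite rmorphB rmorph1 /= piK.
have fq : f ^+ (p ^ k) != 0.
  by rewrite (sub1_pchar_comm _ _ pchar_ga) subr_eq0.
have fpq : f ^+ (p ^ k.+1) = 0.
  by rewrite (sub1_pchar_comm _ _ pchar_ga) (eqP (phi_q _)) subrr.
have := central_part_nilp cf fpq; rewrite central_partX => sum0.
(* [pi] is constant on conjugacy classes, so it kills the part of [f] supported off the centre. *)
have pi_u : pi (central_part f) = f.
  apply/esym/eqP; rewrite -subr_eq0 -[X in X - _]pi_f -rmorphB.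
  set w := f - central_part f; have cw g : w * g = g * w.
    by rewrite mulrBl mulrBr cf central_partP.
  rewrite [w]ga_sum rmorph_sum; apply/eqP.
  apply: (sum_class_fun_eq0 pG) => [g|x y|x Zx]; first exact: mulrn_pchar_ga.
    by rewrite (central_ga_funJ cw) /= !linearZ /= -!/(phi _) phiJ.
  rewrite ga_addE -scaleN1r ga_scaleE central_partE // mulN1r subrr.
  by rewrite scale0r rmorph0.
have [/exists_inP[z Zz /andP[/eqP zq phi_z]] | ] :=
  boolP [exists z in 'Z([set: gT])%g, (z ^+ (p ^ k.+1) == 1)%g && (phi (z ^+
    (p ^ k))%g != 1)]; last first.
  (* Without such a z, group the terms of pi(u^(p^k)) by t = z^(p^(k+1)). Within a group
     phi(z^(p^k)) is constant, since two members differ by a central element whose p^(k+1)-th power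
     is 1. The coefficients in the group add up to 0, since the p-th power of their sum is the
     coefficient of t in u^(p^(k+1)) = 0. *)
  rewrite negb_exists_in => /forall_inP noz; case/eqP: fq.
  rewrite -[in LHS]pi_u -rmorphXn central_partX rmorph_sum.
  rewrite (partition_big (fun z => z ^+ (p ^ k.+1))%g xpredT) //= big1 //
    => t _.
  case: (pickP [pred z | (z \in 'Z([set: gT])%g) && (z ^+ (p ^ k.+1) == t)%g]).
    move=> z0 /= /andP[Zz0 /eqP z0t].
    rewrite (eq_bigr (fun z => ga_fun f z ^+ (p ^ k) *: phi (z0 ^+ (p ^ k))%g)).
      rewrite -scaler_suml [X in X *: _](_ : _ = 0) ?scale0r //.
      apply/eqP; have := congr1 (fun h => ga_fun h t) sum0.
      rewrite ga_fun_sum [RHS]ffunE => sum_t.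
      set S := \sum_(z | _) _; suff /eqP :
        S ^+ p = 0 by rewrite expf_eq0 => /andP[].
      rewrite -(pFrobenius_autE pK) rmorph_sum -[RHS]sum_t big_mkcondr.
      apply: eq_bigr => z Zz; rewrite ga_scaleE ga_eltE eq_sym.
      case: eqP => _; last by rewrite mulr0.
      by rewrite mulr1 /= pFrobenius_autE -exprM expnSr.
    move=> z /andP[Zz /eqP zt]; rewrite /= linearZ /=; congr (_ *: _).
    rewrite -/(phi _) -{1}(mulKVg z0 z) expgMn; last first.
      by case/centerP: Zz0 => _; apply; rewrite inE.
    have Zz0z : (z0^-1 * z)%g \in 'Z([set: gT])%g by rewrite groupM ?groupV.
    have := noz _ Zz0z; rewrite expgMn; last first.
      by apply/commute_sym/commuteV/commute_sym; case/centerP: Zz0 => _;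
        apply; rewrite inE.
    rewrite expVgn z0t zt mulVg eqxx negbK => /eqP phi_z0z.
    by rewrite phiM phi_z0z mulr1.
  by move=> no_z; rewrite big_pred0.
have oz : #[z]%g = (p ^ k.+1)%N.
  have := order_dvdn z (p ^ k.+1); rewrite zq eqxx.
  case/(dvdn_pfactor _ _ (pcharf_prime pK)) => j;
    rewrite leq_eqVlt => /predU1P[-> // | ltjk] ozj.
  case/eqP: phi_z; suff -> : (z ^+ (p ^ k) = 1)%g by [].
  by apply/eqP; rewrite -order_dvdn ozj dvdn_exp2l.
pose N := [set x | phi x == 1].
have gN : group_set N.
  apply/group_setP; split=> [|x y];
    rewrite !inE ?phi1 // => /eqP phix /eqP phiy.
  by rewrite phiM phix phiy mulr1.
have z_neq1 : z != 1%g by apply: contra phi_z => /eqP->; rewrite expg1n phi1.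
exists z; suff [H dH] : exists H :
  {group gT}, (<[z]> \x H)%g = [set: gT]%G by exists H.
apply: (@central_cycle_dprod _ _ (group gN)) => //.
- rewrite /normal subsetT /=; apply/subsetP => y _; rewrite inE.
  by apply/subsetP=> _ /imsetP[x Nx ->]; move: Nx; rewrite !inE phiJ.
- apply: sub_der1_abelian; rewrite gen_subG;
  apply/subsetP=> _ /imset2P[x y _ _ ->].
  by rewrite inE commgEl phiM phiJ -phiM mulVg phi1.
- by move=> x _; rewrite oz inE phiX.
(* By Bezout phi(z^d) = 1 for d = gcd(#[z], i), which is some p^j. If j <= k then phi(z^(p^k)) = 1,
   a contradiction; so d = #[z] and z^i = 1. *)
apply/trivgP/subsetP=> _ /setIP[/cycleP[i ->]]; rewrite inE => phi_zi.
have [a _ /dvdnP[c def_c]] := Bezoutl i (order_gt0 z).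
have phi_gcd : phi (z ^+ gcdn #[z] i)%g == 1.
  have : phi (z ^+ (gcdn #[z] i + a * i))%g == 1.
    by rewrite def_c mulnC expgM expg_order expg1n phi1.
  by rewrite expgD phiM mulnC expgM [phi (_ ^+ i ^+ a)%g]phiX (eqP phi_zi)
    expr1n mulr1.
have := dvdn_gcdl #[z]%g i; rewrite {2}oz.
case/(dvdn_pfactor _ _ (pcharf_prime pK)) => j; rewrite leq_eqVlt.
case/predU1P=> [-> | ltjk] gcd_j.
  by rewrite inE -order_dvdn oz -gcd_j dvdn_gcdr.
case/negP: phi_z; have /dvdnP[d ->] : (gcdn #[z]%g i %| p ^ k)%N.
  by rewrite gcd_j dvdn_exp2l.
by rewrite mulnC expgM phiX (eqP phi_gcd) expr1n.
Qed.

End CentralFactor.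

(** * Nilpotent ideals and tensor splittings *)

Section Nilpotent.

Variables (K : fieldType) (A : falgType K).
Implicit Types (J : {vspace A}) (b : A).

Lemma expv_nil_gt0 J n : (J ^+ n = 0)%VS -> (0 < n)%N.
Proof.
case: n => // /(congr1 (fun U : {vspace A} => 1 \in U)).
by rewrite expv0 memv_line memv0 oner_eq0.
Qed.

Lemma memv_expv J b n : b \in J -> b ^+ n \in (J ^+ n)%VS.
Proof.
by move=> Jb; elim: n => [|n IHn];
  rewrite ?expv0 ?memv_line // expvSl exprS memv_mul.
Qed.

(** Nakayama's argument: iterating the inclusion puts [J] inside all its positive powers. *)
Lemma nilp_subv_prod_eq0 J n : (J ^+ n = 0)%VS -> (J <= J * J)%VS -> J = 0%VS.
Proof.
move=> Jn0 sJ; have := expv_nil_gt0 Jn0; case: n Jn0 => // n Jn0 _.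
apply/eqP; rewrite -subv0 -Jn0; elim: n {Jn0} => [|n IHn];
  first by rewrite expv1.
by apply: subv_trans sJ _; rewrite [in X in (_ <= X)%VS]expvSl prodvSr.
Qed.

(** J^m lies in <b^m> + J^(m+1) for all m, so by nilpotency [J] lies in the algebra generated by
    [b], which is commutative. *)
Lemma nilp_line_commutative J n b :
  (J ^+ n = 0)%VS -> (J * J <= J)%VS -> b \in J -> (J <= <[b]> + J * J)%VS ->
  {in J &, commutative *%R}.
Proof.
move=> Jn0 JJ Jb sJ.
have sbJ : (<[b]> <= J)%VS by rewrite -memvE.
have sJX m : (J ^+ m <= <[b ^+ m]> + J ^+ m.+1)%VS.
  elim: m => [|m IHm]; first by rewrite expv0 expr0 addvSl.
  rewrite [in X in (X <= _)%VS]expvSl.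
  apply: subv_trans (prodvS sJ IHm) _.
  rewrite prodvDl !prodvDr prodv_line -exprS !subv_add addvSl /=.
  rewrite !(subv_trans _ (addvSr _ _)) // [(J ^+ m.+2)%VS]expvSl ?prodvSl //.
  by rewrite -prodvA prodvSr // expvSl prodvSr // -memvE memv_expv.
suff sJS : (J <= agenv <[b]>)%VS.
  move=> x y /(subvP sJS) Sx /(subvP sJS) Sy.
  suff /centvsP : (agenv <[b]> <= 'C(agenv <[b]>))%VS by apply.
  rewrite agenvE; have sC : (<[b]> <= 'C(<[b]>))%VS.
    by apply/centvsP=> _ _ /vlineP[k ->] /vlineP[l ->];
      rewrite -!scalerAl -!scalerAr !scalerA mulrC.
  have sAC V : (<[b]> <= 'C(V))%VS -> (agenv <[b]> <= 'C(V))%VS.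
    move=> sV; apply: agenv_sub_modl; first by rewrite -memvE centv1.
    exact: prodv_sub.
  (* Applied twice: the algebra centralises [b], so [b] centralises the algebra, so the algebra
     centralises itself. *)
  by apply: (sAC); rewrite centvC; apply: sAC.
have sJm m : (J <= agenv <[b]> + J ^+ m.+1)%VS.
  elim: m => [|m IHm]; first by rewrite expv1 addvSr.
  apply: subv_trans IHm _; rewrite subv_add addvSl /=.
  apply: subv_trans (sJX _) _; rewrite addvS // -memvE.
  by apply: (subvP (subX_agenv _ m.+1)); rewrite expv_line memv_line.
have := expv_nil_gt0 Jn0; case: n Jn0 => // n Jn0 _.
by have := sJm n; rewrite Jn0 addv0.
Qed.

End Nilpotent.

Section TensorSplit.

Variables (K : fieldType) (gT : finGroupType).
Local Notation KG := (group_algebra K gT).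
Local Notation I := (aug_ideal K gT).
Implicit Types (B C : {vspace KG}) (f g : KG).

(** Iterating gives f = r^n f, and [r] is nilpotent; this serves in place of inverting 1 - r. *)
Lemma nil_aug_fixed (p : nat) (r f : KG) :
  p \in [pchar K] -> (p.-group [set: gT])%g -> aug r = 0 -> f = r * f -> f = 0.
Proof.
move=> pK pG /eqP; rewrite -mem_aug => Ir frf.
have [n In0] := aug_ideal_nilp pK pG.
have -> : f = r ^+ n * f.
  elim: n {In0} => [|n IHn]; first by rewrite mul1r.
  by rewrite exprSr -mulrA -frf.
by have := memv_expv n Ir; rewrite In0 memv0 => /eqP->; rewrite mul0r.
Qed.

(** Under A = B (x) C this is the map id (x) aug. *)
Definition retract B C (pi : {lrmorphism KG -> KG}) : Prop :=
  [/\ forall f, pi f \in B, {in B, forall b, pi b = b} &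
      {in C, forall c, pi c = (aug c : K)%:A}].

(** All that the argument uses of A = B (x) C. *)
Definition tensor_split B C (piB piC : {lrmorphism KG -> KG}) : Prop :=
  [/\ retract B C piB, retract C B piC, (B * C = fullv)%VS &
      {in B & C, commutative *%R}].

Lemma tensor_split_sym B C piB piC :
  tensor_split B C piB piC -> tensor_split C B piC piB.
Proof.
case=> rB rC BC cBC; split=> // [|c b Cc Bb]; last by rewrite (cBC b c).
apply/eqP; rewrite eqEsubv subvf -BC; apply/prodvP => b c Bb Cc.
by rewrite cBC // memv_mul.
Qed.

Lemma aug_alg (a : K) : aug (a%:A : KG) = a.
Proof. by rewrite linearZ /= rmorph1 [_ *: _]mulr1. Qed.

Section Split.

Variables (B C : {vspace KG}) (piB piC : {lrmorphism KG -> KG}).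
Hypothesis spl : tensor_split B C piB piC.

Lemma tensor_split_ind (P : KG -> Prop) :
  P 0 -> (forall f g, P f -> P g -> P (f + g)) ->
  (forall b c, b \in B -> c \in C -> P (b * c)) -> forall f, P f.
Proof.
move=> P0 PD PM f; have [_ _ BC _] := spl.
have : f \in (B * C)%VS by rewrite BC memvf.
(* [prodv] is the span of the products of basis vectors; each coordinate is absorbed into the first
   factor. *)
rewrite unlock => /coord_span ->; apply: big_ind => // i _.
set X := allpairs_tuple _ _ _.
have /allpairsP[[b c] /= [Bb Cc ->]] : X`_i \in X.
  by apply: mem_nth; rewrite size_tuple.
by rewrite scalerAl; apply: PM; rewrite ?memvZ ?vbasis_mem.
Qed.

Lemma split_aug f : aug (piB f) = aug f.
Proof.
have [[_ idB augB] _ _ _] := spl.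
move: f; apply: tensor_split_ind => [|f g Ef Eg|b c Bb Cc].
- by rewrite !rmorph0.
- by rewrite !rmorphD /= Ef Eg.
by rewrite !rmorphM /= idB // augB // linearZ /= rmorph1 [_ *: _]mulr1.
Qed.

Lemma split_mem1 : 1 \in B.
Proof. by have [[pB _ _] _ _ _] := spl; rewrite -(rmorph1 piB) pB. Qed.

Lemma split_memM : {in B &, forall b b', b * b' \in B}.
Proof.
have [[pB idB _] _ _ _] := spl => b b' Bb Bb'.
by rewrite -(idB b) // -(idB b') // -rmorphM pB.
Qed.

Lemma split_idealM : ((B :&: I) * (B :&: I) <= B :&: I)%VS.
Proof.
apply/prodvP=> b b' /memv_capP[Bb Ib] /memv_capP[Bb' _].
by rewrite memv_cap split_memM ?aug_idealMr.
Qed.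

Lemma split_sub_aug b : b \in B -> b - (aug b : K)%:A \in (B :&: I)%VS.
Proof.
move=> Bb; rewrite memv_cap mem_aug rmorphB /= aug_alg.
by rewrite subrr eqxx andbT memvB ?memvZ ?split_mem1.
Qed.

Lemma split_trivial : (B :&: I = 0)%VS -> C = fullv.
Proof.
move=> B0; have [_ _ BC _] := spl; apply/eqP; rewrite eqEsubv subvf -BC.
apply/prodvP=> b c Bb Cc; have := split_sub_aug Bb.
by rewrite B0 memv0 subr_eq0 => /eqP->; rewrite -scalerAl mul1r memvZ.
Qed.

Lemma split_retractK f : piB (piB f) = piB f.
Proof. by have [[pB idB _] _ _ _] := spl; rewrite idB. Qed.

(** For f = bc the expression is (b - aug b)(c - aug c). So modulo I^2 an element of I is the sum of
    its two retractions, which is the decomposition of I / I^2. *)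
Lemma split_remainder f :
  f - piB f - piC f + (aug f : K)%:A \in (I * I)%VS.
Proof.
have [[pB idB augB] [pC idC augC] _ _] := spl.
move: f; apply: tensor_split_ind => [|f g If Ig|b c Bb Cc].
- by rewrite !rmorph0 !subr0 scale0r addr0 mem0v.
- rewrite !rmorphD /= scalerDl.
  rewrite [- (piB f + _)]opprD [f + g + _]addrACA [- (_ + _)]opprD.
  by rewrite [_ + (- piC f - _)]addrACA [X in X \in _]addrACA memvD.
rewrite !rmorphM /= idB // augB // augC // idC //.
have -> : b * c - b * (aug c : K)%:A - (aug b : K)%:A * c
    + (aug b * aug c : K)%:A = (b - (aug b : K)%:A) * (c - (aug c : K)%:A).
  rewrite mulrBl !mulrBr opprB addrA -!scalerAl !mul1r scalerA.
  by rewrite [RHS]addrAC.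
by apply: memv_mul; rewrite mem_aug rmorphB /= aug_alg subrr.
Qed.

Lemma split_commutative :
  {in (B :&: I)%VS &, commutative *%R} -> {in B &, commutative *%R}.
Proof.
have cA (a : K) (g : KG) : GRing.comm g a%:A.
  by rewrite /GRing.comm mulr_algl mulr_algr.
move=> cI b b' Bb Bb'; rewrite -(subrK (aug b : K)%:A b).
rewrite -(subrK (aug b' : K)%:A b'); apply: commrD; last exact: cA.
apply/commr_sym/commrD; last exact: cA.
exact: cI (split_sub_aug Bb') (split_sub_aug Bb).
Qed.

Lemma split_central : {in B &, commutative *%R} ->
  forall f g, piB f * g = g * piB f.
Proof.
move=> cB f; have [[pB _ _] _ _ cBC] := spl.
apply: tensor_split_ind => [|g h fg fh|b c Bb Cc].
- by rewrite mulr0 mul0r.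
- by rewrite mulrDr mulrDl fg fh.
by rewrite mulrA (cB _ b) // -[RHS]mulrA -(cBC (piB f) c) // mulrA.
Qed.

(** Such a [piB] is the augmentation, so it kills B :&: I, where it is also the identity. *)
Lemma split_nontrivial :
  (forall x, piB (ga_elt K x) = 1) -> C = fullv.
Proof.
move=> piB1; apply: split_trivial; apply/eqP; rewrite -subv0; apply/subvP=> b.
case/memv_capP=> Bb; have [[_ idB _] _ _ _] := spl; rewrite mem_aug => /eqP b0.
rewrite memv0 -(idB b) // [b]ga_sum rmorph_sum.
under eq_bigr do rewrite /= linearZ /= piB1.
by rewrite -scaler_suml [X in X *: _]b0 scale0r.
Qed.

End Split.

End TensorSplit.

(** * Dimension of I / I^2 *)

Section Generators.

Variables (K : fieldType) (gT : finGroupType).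
Local Notation KG := (group_algebra K gT).
Local Notation I := (aug_ideal K gT).
Implicit Types (B C : {vspace KG}) (f g : KG).

(** Modulo I^2 the map x |-> x - 1 turns products into sums. *)
Lemma ga_eltM_sub1 (x y : gT) :
  ga_elt K (x * y)%g - 1 = (ga_elt K x - 1) * (ga_elt K y - 1)
    + ((ga_elt K x - 1) + (ga_elt K y - 1)).
Proof.
rewrite addrA -{2}(mulr1 (ga_elt K x - 1)) -mulrDr subrK mulrBl mul1r.
by rewrite -ga_eltM addrA subrK.
Qed.

(** The x with x - 1 in [X + I * I] form a subgroup containing [S], and the elements x - 1 span
    I. *)
Lemma dim_aug_ideal (S : {set gT}) :
  <<S>>%g = [set: gT] -> (\dim I <= #|S| + \dim (I * I))%N.
Proof.
move=> genS; pose X := <<[seq ga_elt K x - 1 | x in S]>>%VS.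
suff sI : (I <= X + I * I)%VS.
  apply: leq_trans (dimvS sI) _; apply: leq_trans (dimv_add_leqif _ _) _.
  by rewrite leq_add2r (leq_trans (dim_span _)) // size_image.
pose N := [set x | ga_elt K x - 1 \in (X + I * I)%VS].
have gN : group_set N.
  apply/group_setP; split=> [|x y]; rewrite !inE.
    by rewrite -[ga_elt K 1%g]/(1 : KG) subrr mem0v.
  rewrite ga_eltM_sub1 => Nx Ny; apply: memvD; last exact: memvD.
  by apply: (subvP (addvSr _ _)); rewrite memv_mul ?aug_sub1.
apply: aug_ideal_min => x.
have : x \in <<S>>%g by rewrite genS inE.
suff /subsetP sN : <<S>>%g \subset Group gN by move/sN; rewrite inE.
rewrite gen_subG; apply/subsetP=> s Ss; rewrite inE.
by apply: (subvP (addvSl _ _)); apply/memv_span/image_f.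
Qed.

End Generators.

Section SplitDimension.

Variables (K : fieldType) (gT : finGroupType).
Local Notation KG := (group_algebra K gT).
Local Notation I := (aug_ideal K gT).
Variables (B C : {vspace KG}) (piB piC : {lrmorphism KG -> KG}).
Hypothesis spl : tensor_split B C piB piC.

(** [X] is a complement of I^2 in I and stands for I / I^2; [X0 pi] is the kernel of the map that
    [pi] induces on it. *)
Let X := (I :\: (I * I))%VS.
Let X0 (pi : {lrmorphism KG -> KG}) : {vspace KG} :=
  (X :&: (linfun pi @^-1: (I * I)))%VS.

(** By [split_remainder], an element of I that both retractions send into I^2 is itself in I^2, so
    the two kernels are independent. *)
Lemma dim_split_complement :
  (\dim (X0 piC) + \dim (X0 piB) <= \dim X)%N.
Proof.
rewrite -dimv_disjoint_sum; first by rewrite dimvS // subv_add !capvSl.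
apply/eqP; rewrite -subv0; apply/subvP=> f.
case/memv_capP=> /memv_capP[Xf]; rewrite -memv_preim lfunE /= => fC.
case/memv_capP=> _; rewrite -memv_preim lfunE /= => fB.
have If : f \in I by apply: (subvP (diffvSl _ _)) Xf.
suff f2 : f \in (I * I)%VS by rewrite -(capv_diff I (I * I)) memv_cap Xf.
have := split_remainder spl f; move: If; rewrite mem_aug => /eqP->.
rewrite scale0r addr0 => fBC.
by rewrite -(subrK (piB f) f) memvD // -(subrK (piC f) (f - _)) memvD.
Qed.

Lemma split_limg_aug : (linfun piB @: I <= B :&: I)%VS.
Proof.
have [[pB _ _] _ _ _] := spl.
apply/subvP=> _ /memv_imgP[f If ->]; rewrite lfunE memv_cap pB.
by rewrite mem_aug /= (split_aug spl) -mem_aug.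
Qed.

(** Write b in B :&: I as x + q with x in [X] and q in I^2. As piC b = 0, piC x = - piC q lies in
    I^2, so x is in [X0 piC]; then apply [piB] to b = x + q. *)
Lemma split_generators :
  (B :&: I <= linfun piB @: X0 piC + (B :&: I) * (B :&: I))%VS.
Proof.
have [[pB idB augB] [pC idC augC] _ _] := spl.
have sII := split_limg_aug.
have piM V W (pi : {lrmorphism KG ->
  KG}) : (linfun pi @: (V * W) <= (linfun pi @: V) * (linfun pi @: W))%VS.
  apply/subvP=> _ /memv_imgP[f VWf ->].
  suff : f \in (linfun pi @^-1: (linfun pi @: V * linfun pi @: W))%VS by
    rewrite memv_preim.
  apply: (subvP _ _ VWf); apply/prodvP=> v w Vv Ww.
  rewrite -memv_preim lfunE /= rmorphM memv_mul //.
    by have := memv_img (linfun pi) Vv; rewrite lfunE.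
  by have := memv_img (linfun pi) Ww; rewrite lfunE.
apply/subvP=> b /memv_capP[Bb Ib].
have : b \in (X + I * I)%VS.
  suff -> : (X + I * I = I)%VS by [].
  rewrite addv_diff; apply/addv_idPl/prodvP=> f g If _.
  exact: aug_idealMr.
case/memv_addP=> x Xx [q Iq def_b].
rewrite -(idB b) // {1}def_b rmorphD; apply: memv_add; last first.
  apply: (subvP (prodvS sII sII)); apply: (subvP (piM _ _ _)).
  by have := memv_img (linfun piB) Iq; rewrite lfunE.
suff : x \in X0 piC by move/(memv_img (linfun piB)); rewrite lfunE.
rewrite memv_cap Xx -memv_preim lfunE /=.
have : piC b = 0 by move: Ib; rewrite augC // mem_aug => /eqP->;
  rewrite scale0r.
rewrite def_b rmorphD => /eqP; rewrite addr_eq0 => /eqP->; rewrite memvN.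
have sIIC : (linfun piC @: I <= I)%VS.
  apply/subvP=> _ /memv_imgP[f If ->]; rewrite lfunE.
  by rewrite mem_aug /= (split_aug (tensor_split_sym spl)) -mem_aug.
apply: (subvP (prodvS sIIC sIIC)); apply: (subvP (piM _ _ _)).
by have := memv_img (linfun piC) Iq; rewrite lfunE.
Qed.

End SplitDimension.

(** * Cyclic derived subgroup *)

Section CyclicDerived.

Variables (K : fieldType) (gT : finGroupType) (c : gT) (p : nat).
Hypothesis der1_c : ([set: gT]^`(1) = <[c]>)%g.
Hypotheses (pK : p \in [pchar K]) (pG : (p.-group [set: gT])%g).
Local Notation KG := (group_algebra K gT).
Local Notation I := (aug_ideal K gT).
Implicit Types (B C V : {vspace KG}) (f g : KG).

Let y : KG := ga_elt K c - 1.
(** Left ideals by construction. They are two-sided because y f and f y differ by a commutator,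
    which is again a left multiple of y. *)
Let L1 : {vspace KG} := (fullv * <[y]>)%VS.
Let L : {vspace KG} := (I * <[y]>)%VS.

Lemma mem_der1 (x : gT) : x \in <[c]>%g -> ga_elt K x - 1 \in L1.
Proof.
case/cycleP=> n ->; elim: n => [|n IHn].
  by rewrite -[ga_elt K _]/(1 : KG) subrr mem0v.
rewrite expgSr ga_eltM_sub1 -/y -{2}(mul1r y) addrCA -mulrDl memvD //.
by apply/memv_cosetP; exists (ga_elt K (c ^+ n)%g - 1 + 1); rewrite ?memvf.
Qed.

Lemma ga_commutator_sub V :
  (forall x z : gT, ga_elt K x * ga_elt K z - ga_elt K z * ga_elt K x \in V) ->
  forall f g, f * g - g * f \in V.
Proof.
move=> sV f g; rewrite [f]ga_sum mulr_suml mulr_sumr -sumrB.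
apply: memv_suml => x _; rewrite -scalerAl -scalerAr -scalerBr memvZ //.
rewrite [g]ga_sum mulr_suml mulr_sumr -sumrB.
by apply: memv_suml => z _; rewrite -scalerAl -scalerAr -scalerBr memvZ.
Qed.

Lemma ga_elt_commutator (x z : gT) :
  ga_elt K x * ga_elt K z - ga_elt K z * ga_elt K x =
  ga_elt K (z * x)%g * (ga_elt K [~ x, z]%g - 1).
Proof. by rewrite mulrBr mulr1 -!ga_eltM -commgC. Qed.

Lemma commutator_L1 f g : f * g - g * f \in L1.
Proof.
apply: ga_commutator_sub => x z; rewrite ga_elt_commutator.
have /memv_cosetP[r _ ->] : ga_elt K [~ x, z]%g - 1 \in L1.
  by apply: mem_der1; rewrite -der1_c mem_commg ?inE.
by apply/memv_cosetP; exists (ga_elt K (z * x)%g * r); rewrite ?memvf ?mulrA.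
Qed.

Lemma mul_y f : y * f \in L1.
Proof.
by rewrite -(subrK (f * y) (y * f)) memvD ?commutator_L1 ?memv_mul ?memvf
  ?memv_line.
Qed.

Lemma mulLl f g : g \in L -> f * g \in L.
Proof.
case/memv_cosetP=> r Ir ->; apply/memv_cosetP; exists (f * r);
  rewrite ?mulrA //.
exact: aug_idealMl.
Qed.

Lemma mulLr f g : g \in L -> g * f \in L.
Proof.
case/memv_cosetP=> r Ir ->; have /memv_cosetP[s _ yf] := mul_y f.
apply/memv_cosetP; exists (r * s); first exact: aug_idealMr.
by rewrite -!mulrA yf.
Qed.

(* [b, b'] = r y with aug r != 0 would make piC r invertible, and then
   piC y = 0, since piC kills [b, b']; but piC y divides all commutators of C. *)
Lemma commutator_L B C (piB piC : {lrmorphism KG -> KG}) :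
  tensor_split B C piB piC -> ~~ (C <= 'C(C))%VS ->
  {in B &, forall b b', b * b' - b' * b \in L}.
Proof.
move=> spl ncC b b' Bb Bb'; have [[pB idB augB] [pC idC augC] _ _] := spl.
have /memv_cosetP[r _ def_r] := commutator_L1 b b'.
rewrite def_r; apply/memv_cosetP; exists r => //; rewrite mem_aug.
apply: contraR ncC => nz_r.
have piCry : piC r * piC y = 0.
  rewrite -rmorphM -def_r rmorphB !rmorphM /= !augC //
    -!scalerAl !mul1r !scalerA.
  by rewrite mulrC subrr.
have piCy : piC y = 0.
  apply: (nil_aug_fixed (r := 1 - (aug r : K)^-1 *: piC r) pK pG).
    rewrite rmorphB rmorph1 /= linearZ /= (split_aug (tensor_split_sym spl)).
    by rewrite [_ *: _]mulVf ?subrr.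
  by rewrite mulrBl mul1r -scalerAl piCry scaler0 subr0.
apply/centvsP => d d' Cd Cd'; apply/eqP; rewrite -subr_eq0.
have /memv_cosetP[s _ def_s] := commutator_L1 d d'.
by rewrite -(idC d) // -(idC d') //
  -!rmorphM -rmorphB def_s rmorphM /= piCy mulr0.
Qed.

Lemma split_cyclic_der1 B C (piB piC : {lrmorphism KG -> KG}) :
  tensor_split B C piB piC -> (B <= 'C(B))%VS || (C <= 'C(C))%VS.
Proof.
move=> spl; apply: contraT; rewrite negb_or => /andP[ncB ncC].
have cB := commutator_L spl ncC.
have cC := commutator_L (tensor_split_sym spl) ncB.
have [_ _ _ cBC] := spl.
have allL f g : f * g - g * f \in L.
  move: f; apply: (tensor_split_ind spl) => [|f f' Lf Lf'|b d Bb Cd].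
  - by rewrite mul0r mulr0 subrr mem0v.
  - by rewrite mulrDl mulrDr opprD addrACA memvD.
  move: g; apply: (tensor_split_ind spl) => [|g g' Lg Lg'|b' d' Bb' Cd'].
  - by rewrite mul0r mulr0 subrr mem0v.
  - by rewrite mulrDl mulrDr opprD addrACA memvD.
  (* As [B] and [C] commute, commutators of products reduce to commutators inside each factor. *)
  have -> : b * d * (b' * d') - b' * d' * (b * d) =
     (b * b' - b' * b) * (d * d') + b' * b * (d * d' - d' * d).
    rewrite mulrBl mulrBr addrA subrK.
    by rewrite !mulrA -(mulrA b d) -(cBC b' d) //
      -(mulrA b' d') -(cBC b d') // !mulrA.
  by apply: memvD; [apply/mulLr/cB | apply/mulLl/cC].
(* [L] is an ideal, so this is a subgroup; it contains all group commutators, hence [c], which puts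
   y in I y. *)
pose N := [set x | ga_elt K x - 1 \in L].
have gN : group_set N.
  apply/group_setP; split=> [|x z]; rewrite !inE.
    by rewrite -[ga_elt K 1%g]/(1 : KG) subrr mem0v.
  by rewrite ga_eltM_sub1 => Nx Nz; rewrite memvD ?mulLl // memvD.
have /subsetP/(_ c (cycle_id c)) : <[c]>%g \subset Group gN.
  rewrite -der1_c gen_subG; apply/subsetP=> _ /imset2P[x z _ _ ->]; rewrite inE.
  have <- : ga_elt K (z * x)^-1%g * (ga_elt K x * ga_elt K z - ga_elt K z *
    ga_elt K x) =
      ga_elt K [~ x, z]%g - 1.
    by rewrite ga_elt_commutator mulrA -ga_eltM mulVg -[ga_elt K 1%g]/(1 :
      KG) mul1r.
  exact: mulLl.
rewrite inE => /memv_cosetP[r];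
  rewrite mem_aug => /eqP r0 /(nil_aug_fixed pK pG r0) y0.
case/centvsP: ncB => b b' _ _; apply/eqP; rewrite -subr_eq0.
by have /memv_cosetP[s _ ->] := commutator_L1 b b'; rewrite /y y0 mulr0.
Qed.

End CyclicDerived.

(** * Exclusion of proper splittings *)

Section Assembly.

Variables (K : fieldType) (gT : finGroupType) (p : nat).
Hypotheses (pK : p \in [pchar K]) (pG : (p.-group [set: gT])%g).
Local Notation KG := (group_algebra K gT).
Local Notation I := (aug_ideal K gT).
Implicit Types (B C : {vspace KG}) (piB piC : {lrmorphism KG -> KG}).

Lemma aug_capX_nilp B : exists n, ((B :&: I) ^+ n = 0)%VS.
Proof.
have [n In0] := aug_ideal_nilp pK pG; exists n.
by apply/eqP; rewrite -subv0 -In0 expvS ?capvSr.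
Qed.

(** [XB] and [XC] are images of independent subspaces of a copy of I / I^2, whose dimension is at
    most the number of generators. *)
Lemma split_rank_dichotomy (S : {set gT}) B C piB piC :
  tensor_split B C piB piC -> <<S>>%g = [set: gT] ->
  exists XB XC : {vspace KG},
  [/\ (XB <= B :&: I)%VS, (B :&: I <= XB + (B :&: I) * (B :&: I))%VS,
      (XC <= C :&: I)%VS, (C :&: I <= XC + (C :&: I) * (C :&: I))%VS &
      (\dim XB + \dim XC <= #|S|)%N].
Proof.
move=> spl genS; have lps := tensor_split_sym spl.
pose X := (I :\: (I * I))%VS.
have dX : (\dim X <= #|S|)%N.
  rewrite -(leq_add2r (\dim (I * I))) -dimv_disjoint_sum ?capv_diff //
    addv_diff.
  rewrite (addv_idPl _); first exact: dim_aug_ideal.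
  by apply/prodvP=> f g If _; apply: aug_idealMr.
pose XB := (linfun piB @: (X :&: linfun piC @^-1: (I * I)))%VS.
pose XC := (linfun piC @: (X :&: linfun piB @^-1: (I * I)))%VS.
have sXI V : (X :&: V <= I)%VS by apply: subv_trans (capvSl _ _) (diffvSl _ _).
exists XB, XC; split.
- by apply: subv_trans (split_limg_aug spl); apply: limgS.
- exact: split_generators spl.
- by apply: subv_trans (split_limg_aug lps); apply: limgS.
- exact: split_generators lps.
apply: leq_trans dX; apply: leq_trans (dim_split_complement spl).
have le_limg (h : 'End(KG)) U : (\dim (h @: U) <= \dim U)%N.
  by rewrite -(limg_ker_dim h U) leq_addl.
by apply: leq_add; apply: le_limg.
Qed.

Lemma rank0_trivial B C piB piC (X : {vspace KG}) :
  tensor_split B C piB piC -> (B :&: I <= X + (B :&: I) * (B :&: I))%VS ->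
  \dim X = 0%N -> C = fullv.
Proof.
move=> spl sX /eqP; rewrite dimv_eq0 => /eqP X0; apply: (split_trivial spl).
have [n Jn0] := aug_capX_nilp B; apply: (nilp_subv_prod_eq0 Jn0).
by rewrite X0 add0v in sX.
Qed.

Lemma rank1_commutative B C piB piC (X : {vspace KG}) :
  tensor_split B C piB piC -> (X <= B :&: I)%VS ->
  (B :&: I <= X + (B :&: I) * (B :&: I))%VS ->
  (\dim X <= 1)%N -> {in B &, commutative *%R}.
Proof.
move=> spl sXB sX dX; apply: (split_commutative spl).
have [n Jn0] := aug_capX_nilp B.
(* [vpick X] is 0 when [X] is 0, so it spans [X] in dimension 0 as well as in dimension 1. *)
apply: (nilp_line_commutative Jn0 (split_idealM spl) (b := vpick X)).
  by apply: (subvP sXB); apply: memv_pick.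
apply: subv_trans sX _; rewrite addvS //.
suff defX : <[vpick X]>%VS = X by rewrite defX.
apply/eqP; rewrite eqEdim -memvE memv_pick dim_vline vpick0 -dimv_eq0.
by case: (\dim X) dX => [|[]].
Qed.

Lemma split_commutative_absurd B C piB piC :
  (forall H L : {group gT}, (H \x L)%g = [set: gT] -> H :=: 1%g \/ L :=: 1%g) ->
  tensor_split B C piB piC -> B != fullv -> C != fullv ->
  ~ {in C &, commutative *%R}.
Proof.
move=> indec spl nB nC cC; have lps := tensor_split_sym spl.
have [|z [H [nz_z dH]]] := central_retract_dprod pK pG (split_retractK lps)
  (split_central lps cC).
  apply/existsP; apply: contraR nB; rewrite negb_exists => /forallP pi1.
  apply/eqP/(split_nontrivial lps) => x; apply/eqP.
  by have := pi1 x; rewrite negbK.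
(* Since z is not 1, indecomposability leaves H = 1, so z generates the group. With one generator,
   [XB] or [XC] must then be 0. *)
have genz : <<[set z]>>%g = [set: gT].
  have [/eqP|H1] := indec <[z]>%G H dH; first by rewrite cycle_eq1 (negPf nz_z).
  by move: dH; rewrite H1 dprodg1.
have [XB [XC [_ sB _ sC]]] := split_rank_dichotomy spl genz.
rewrite cards1; case: (posnP (\dim XB)) => [XB0 _ | XB_gt0 dX].
  by case/eqP: nC; apply: rank0_trivial spl sB XB0.
case/eqP: nB; apply: rank0_trivial lps sC _.
by apply/eqP; rewrite -leqn0 -(leq_add2l 1) (leq_trans _ dX) // leq_add2r.
Qed.

Lemma split_generators3_or_cyclic_der1 B C piB piC (S : {set gT}) :
  tensor_split B C piB piC ->
  (<<S>>%g = [set: gT] /\ (#|S| <= 3)%N) \/ cyclic [set: gT]^`(1)%g ->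
  {in B &, commutative *%R} \/ {in C &, commutative *%R}.
Proof.
move=> spl [[genS S3]|/cyclicP[c der1_c]]; last first.
  by have /orP[/centvsP|/centvsP] := split_cyclic_der1 der1_c pK pG spl;
    [left | right].
have [XB [XC [XBB sB XCC sC dX]]] := split_rank_dichotomy spl genS.
have [XB1 | XB2] := leqP (\dim XB) 1.
  by left; apply: (rank1_commutative spl XBB sB XB1).
right; apply: (rank1_commutative (tensor_split_sym spl) XCC sC).
by rewrite -(leq_add2l 2) (leq_trans _ (leq_trans dX S3)) // leq_add2r.
Qed.

End Assembly.

(** * Retractions obtained from the tensor product, and the theorem *)

Lemma internal_tensor_lift (K : fieldType) (A : falgType K) (B C : {aspace A})
    (hB : subvs_of B -> A) (hC : subvs_of C -> A) :
  internal_tensor B C -> linear hB -> linear hC ->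
  GRing.monoid_morphism hB -> GRing.monoid_morphism hC ->
  (forall b c, hB b * hC c = hC c * hB b) ->
  exists pi : {lrmorphism A -> A},
    forall b c, pi (vsval b * vsval c) = hB b * hC c.
Proof.
case=> _ _ _ [f [fE [f' fK f'K]]] linB linC [hB1 hBM] [hC1 hCM] hBC.
pose g : tensor (subvs_of B) (subvs_of C) ->
  A := tens_lift (fun b c => hB b * hC c).
have linl c : linear (fun b => hB b * hC c).
  by move=> a b b'; rewrite linB mulrDl scalerAl.
have linr b : linear (fun c => hB b * hC c).
  by move=> a c c'; rewrite linC mulrDr scalerAr.
have gE b c : g (tens b c) = hB b * hC c by exact: tens_liftE.
have glin : linear g by exact: tens_lift_linear.
(* By bilinearity this is checked on pure tensors, where [hBC] swaps the two middle factors. *)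
have gM : {morph g : s t / s * t}.
  move=> s t; move: s; apply: tens_ext => [a s s'|a s s'|b c].
  - by rewrite mulrDl -scalerAl glin.
  - by rewrite glin mulrDl -scalerAl.
  move: t; apply: tens_ext => [a t t'|a t t'|b' c'].
  - by rewrite mulrDr -scalerAr glin.
  - by rewrite glin mulrDr -scalerAr.
  by rewrite tensM !gE hBM hCM -!mulrA (mulrA (hB b')) hBC -!mulrA.
have pilin : linear (g \o f').
  by move=> a x z; rewrite /= (can2_linear fK f'K) glin.
have pimon : GRing.monoid_morphism (g \o f').
  have [f'1 f'M] := can2_monoid_morphism fK f'K.
  by split=> [|x z]; rewrite /= ?f'1 ?gE ?hB1 ?hC1 ?mulr1 // f'M gM.
pose PI : {lrmorphism A -> A} := HB.pack (g \o f')
  (GRing.isLinear.Build K A A *:%R _ pilin)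
  (GRing.isMonoidMorphism.Build A A _ pimon).
by exists PI => b c; rewrite /= -fE fK gE.
Qed.

(** [piB] glues the inclusion of [B] with the augmentation on [C], and [piC] does the reverse. *)
Lemma internal_tensor_split (K : fieldType) (gT : finGroupType)
    (B C : {aspace group_algebra K gT}) :
  internal_tensor B C ->
  exists piB piC : {lrmorphism group_algebra K gT -> group_algebra K gT},
    tensor_split B C piB piC.
Proof.
move=> BC; have [B1 C1 cBC [f [fE f_bij]]] := BC.
(* The unit of [subvs_of D] is the relative identity of [D], which is 1 because [D] contains 1. *)
have vsM (D : {aspace group_algebra K gT}) : 1 \in D ->
    GRing.monoid_morphism (vsval : subvs_of D -> _).
  by rewrite -algid_eq1 => /eqP D1; split.
have vslin (D : {aspace group_algebra K gT}) : linear (vsval :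
  subvs_of D -> group_algebra K gT).
  by move=> a x z; rewrite linearP.
pose e (D : {aspace group_algebra K gT}) (d : subvs_of D) :
  group_algebra K gT :=
  (aug (vsval d) : K)%:A.
have elin D : linear (@e D).
  by move=> a x z; rewrite /e !linearP scalerDl scalerA.
have eM (D : {aspace group_algebra K gT}) : 1 \in D ->
  GRing.monoid_morphism (@e D).
  move=> /vsM[D1 DM]; split=> [|x z]; rewrite /e.
    by rewrite D1 rmorph1 scale1r.
  by rewrite DM rmorphM /= mulr_algl scalerA.
have [piB piBE] := internal_tensor_lift BC (vslin B) (@elin C)
  (vsM B B1) (eM C C1) (fun b c => esym (etrans (mulr_algl _ _) (esym
    (mulr_algr _ _)))).
have [piC piCE] := internal_tensor_lift BC (@elin B) (vslin C)
  (eM B B1) (vsM C C1) (fun b c => (etrans (mulr_algl _ _) (esym (mulr_algr _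
    _)))).
have mem_of (V : {vspace group_algebra K gT}) (h :
  {linear group_algebra K gT -> group_algebra K gT}) :
    (forall (b : subvs_of B) (c :
      subvs_of C), h (vsval b * vsval c) \in V) -> forall a, h a \in V.
  move=> hV a; have [f' fK f'K] := f_bij; rewrite -(f'K a); move: (f' a) => t.
  (* Membership becomes an equality of linear maps, which [tens_ext] checks on pure tensors. *)
  suff -> : h (f t) = projv V (h (f t)) by apply: memv_proj.
  move: t; apply: tens_ext => [k s u|k s u|b c]; rewrite ?linearP //.
  by rewrite fE projv_id ?hV.
have BCf : (B * C = fullv)%VS.
  apply/eqP; rewrite eqEsubv subvf; apply/subvP=> a _.
  by apply: (mem_of _ idfun) => b c; apply: memv_mul; apply: subvsP.
have fix_of (D : {aspace group_algebra K gT}) (P : group_algebra K gT -> Prop) :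
    (forall d : subvs_of D, P (vsval d)) -> {in D, forall d, P d}.
  by move=> PD d Dd; apply: (PD (Subvs Dd)).
have one_of (D : {aspace group_algebra K gT}) : 1 \in D ->
    vsval (1 : subvs_of D) = 1 by move/vsM=> [].
have e1 (D : {aspace group_algebra K gT}) : 1 \in D -> e D 1 = 1.
  by move/eM=> [].
exists piB, piC; split=> //; split.
- by apply: mem_of => b c; rewrite /= piBE /e mulr_algr memvZ ?subvsP.
- by apply: fix_of => b; rewrite -[vsval b in LHS]mulr1 -(one_of C) //
  piBE e1 ?mulr1.
- by apply: fix_of => c; rewrite -[vsval c in LHS]mul1r -(one_of B) //
  piBE !one_of ?mul1r.
- by apply: mem_of => b c; rewrite /= piCE /e mulr_algl memvZ ?subvsP.
- by apply: fix_of => c; rewrite -[vsval c in LHS]mul1r -(one_of B) //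
  piCE e1 ?mul1r.
- by apply: fix_of => b; rewrite -[vsval b in LHS]mulr1 -(one_of C) //
  piCE !one_of ?mulr1.
Qed.

Local Open Scope group_scope.

Theorem corollary0p3 (p : nat) (gT : finGroupType) (G : {group gT}) :
  prime p -> p.-group G -> direct_indecomposable G ->
  (exists x y z : gT, G :=: <<[set x; y; z]>>) \/ cyclic G^`(1) ->
  ~ exists B C : {aspace group_algebra 'F_p (subg_of G)},
      [/\ B != fullv :> {vspace _}, C != fullv :> {vspace _} &
          internal_tensor B C].
Proof.
move=> p_pr pG indec gens [B [C [nB nC /internal_tensor_split[piB [piC spl]]]]].
have pF : p \in [pchar 'F_p] by apply: pchar_Fp.
(* The hypotheses on [G] are carried along the injection [sgval] to the full group on
   [subg_of G]. *)
have imT : (sgval @* [set: subg_of G] = G)%g by exact: im_sgval.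
have injs : ('injm (@sgval _ G))%g by apply: injm_sgval.
have pS : (p.-group [set: subg_of G])%g by rewrite -(injm_pgroup injs) ?imT
  ?subsetT.
have indecS (H L : {group subg_of G}) : (H \x L)%g = [set: subg_of G] ->
    H :=: 1%g \/ L :=: 1%g.
  move=> /(injm_dprod (subxx _) injs) /=.
  rewrite imT => /indec[] /trivgP H1; [left|right]; apply/trivgP.
  - by rewrite -(injmSK injs) ?subsetT // morphim1.
  - by rewrite -(injmSK injs) ?subsetT // morphim1.
have [S genS] : exists S : {set subg_of G},
    (<<S>>%g = [set: subg_of G] /\ (#|S| <= 3)%N)
      \/ cyclic [set: subg_of G]^`(1)%g.
  case: gens => [[x [y [z defG]]] | cG]; last first.
    exists set0; right.
    by rewrite -(injm_cyclic injs) ?subsetT // morphim_der ?imT.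
  have sSG : [set x; y; z] \subset G by rewrite defG subset_gen.
  exists (subg G @* [set x; y; z])%g; left; split.
    by rewrite -morphim_gen // -defG -[in X in (_ @* X)%g]imT sgvalmK.
  apply: leq_trans (leq_morphim _ _) _.
  apply: leq_trans (leq_card_setU _ _) _.
  by rewrite cards2 cards1; case: (x != y).
have [cB | cC] := split_generators3_or_cyclic_der1 pF pS spl genS.
  exact (split_commutative_absurd pF pS indecS (tensor_split_sym spl) nC nB cB).
exact (split_commutative_absurd pF pS indecS spl nB nC cC).
Qed.
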